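(* For all positive integers $n$, we have $$|s^{-1}(\mathrm{Av}_n(132,312))|=|s^{-1}(\mathrm{Av}_n(231,312))|.$$ In fact, for every integer $m\ge 0$, the number of permutations in $s^{-1}(\mathrm{Av}_n(132,312))$ with exactly $m$ descents is the same as the number of permutations in $s^{-1}(\mathrm{Av}_n(231,312))$ with exactly $m$ descents. Moreover, for every integer $m\ge 0$, the number of permutations in $s^{-1}(\mathrm{Av}_n(132,312))$ with exactly $m$ peaks is the same as the number of permutations in $s^{-1}(\mathrm{Av}_n(231,312))$ with exactly $m$ peaks.
   Context: $S_n$ is the set of permutations of $\{1,\ldots,n\}$, written as words. The stack-sorting map $s$ is defined recursively on words of distinct positive integers: $s$ sends the empty word to itself, and if $\pi=LNR$ where $N$ is the largest entry of $\pi$, then $s(\pi)=s(L)s(R)N$. Thus $s$ maps $S_n$ to $S_n$, and $s^{-1}(A)=\{\sigma\in S_n: s(\sigma)\in A\}$ for $A\subseteq S_n$. $\mathrm{Av}_n(\tau^{(1)},\ldots,\tau^{(r)})$ is the set of permutations in $S_n$ avoiding (in the classical sense) all the patterns $\tau^{(1)},\ldots,\tau^{(r)}$. A descent of $\pi\in S_n$ is an index $i\in\{1,\ldots,n-1\}$ with $\pi_i>\pi_{i+1}$; a peak is an index $i\in\{2,\ldots,n-1\}$ with $\pi_{i-1}<\pi_i>\pi_{i+1}$. *)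

(* Defs.v *)
From mathcomp Require Import all_boot all_fingroup.

Set Implicit Arguments.
Unset Strict Implicit.
Unset Printing Implicit Defensive.

(* [k] is fuel; see [stack_sort_nil] and [stack_sort_max] below for the
   defining recursion s(LNR) = s(L)s(R)N. *)
Fixpoint stack_sort_rec (k : nat) (w : seq nat) : seq nat :=
  if k is k'.+1 then
    if w is [::] then [::] else
      let N := \max_(x <- w) x in
      let L := take (index N w) w in
      let R := drop (index N w).+1 w in
      stack_sort_rec k' L ++ stack_sort_rec k' R ++ [:: N]
  else [::].

Definition stack_sort (w : seq nat) : seq nat := stack_sort_rec (size w) w.

Lemma stack_sort_rec_nil k : stack_sort_rec k [::] = [::].
Proof. by case: k. Qed.

Lemma max_mem (w : seq nat) : w != [::] -> \max_(x <- w) x \in w.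
Proof.
elim: w => // a w IHw _; rewrite big_cons inE.
case: (eqVneq w [::]) => [->|/IHw IH]; first by rewrite big_nil maxn0 eqxx.
by case: (leqP a (\max_(j <- w) j)) => _; rewrite ?IH ?orbT ?eqxx.
Qed.

Lemma stack_sort_recS k w (i := index (\max_(x <- w) x) w) : w != [::] ->
  stack_sort_rec k.+1 w =
  stack_sort_rec k (take i w) ++ stack_sort_rec k (drop i.+1 w) ++
    [:: \max_(x <- w) x].
Proof. by move: @i; case: w. Qed.

Lemma size_split_max w (i := index (\max_(x <- w) x) w) : w != [::] ->
  size (take i w) < size w /\ size (drop i.+1 w) < size w.
Proof.
move=> w0; have iw : i < size w by rewrite index_mem max_mem.
by rewrite size_takel ?size_drop ?(ltnW iw) //; split=> //; rewrite ltn_subrL (leq_trans _ iw).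
Qed.

Lemma stack_sort_rec_size k w :
  size w <= k -> stack_sort_rec k w = stack_sort w.
Proof.
rewrite /stack_sort.
have [m] := ubnP (size w); elim: m => // m IHm in k w *.
have [->|w0] := eqVneq w [::]; first by rewrite !stack_sort_rec_nil.
have [sL sR] := size_split_max w0; rewrite ltnS => sm.
case: k => [|k sk]; first by rewrite leqn0 size_eq0 (negPf w0).
case sw: (size w) => [|l]; first by rewrite sw in sL.
rewrite !stack_sort_recS //.
have fuel v : size v < size w -> stack_sort_rec k v = stack_sort_rec l v.
  move=> vw; have vm := leq_trans vw sm.
  by rewrite (IHm k) ?(IHm l) // -ltnS -?sw // (leq_trans vw).
by rewrite !fuel.
Qed.

Lemma stack_sort_nil : stack_sort [::] = [::].
Proof. by []. Qed.

Lemma stack_sort_max L N R :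
    all (fun x => x < N) L -> all (fun x => x < N) R ->
  stack_sort (L ++ N :: R) = stack_sort L ++ stack_sort R ++ [:: N].
Proof.
move=> ltL ltR; set w := L ++ N :: R.
have maxw : \max_(x <- w) x = N.
  have leN s : all (fun x => x < N) s -> \max_(x <- s) x <= N.
    by move=> /allP lts; apply/bigmax_leqP_seq => x /lts /ltnW.
  by rewrite /w big_cat big_cons /= (maxn_idPl (leN _ ltR)) (maxn_idPr (leN _ ltL)).
have NL : N \notin L by apply/negP => /(allP ltL); rewrite ltnn.
have iN : index N w = size L by rewrite index_cat (negPf NL) /= eqxx addn0.
have w0 : w != [::] by rewrite /w; case: (L).
have := size_split_max w0; rewrite -(@stack_sort_rec_size (size w).+1 w) //.
rewrite stack_sort_recS // maxw iN.
have -> : take (size L) w = L by rewrite /w take_size_cat.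
have -> : drop (size L).+1 w = R.
  by rewrite /w -cat_rcons drop_size_cat ?size_rcons.
by case=> /ltnW sL /ltnW sR; rewrite !stack_sort_rec_size.
Qed.

Lemma stack_sort_perm_eq w : perm_eq (stack_sort w) w.
Proof.
suff main k v : size v <= k -> perm_eq (stack_sort_rec k v) v by apply: main.
elim: k v => {w} [|k IHk] w sk; first by case: w sk.
have [->|w0] := eqVneq w [::]; first by [].
have [sL sR] := size_split_max w0.
rewrite stack_sort_recS //; set i := index _ w in sL sR *.
rewrite -[X in perm_eq _ X](cat_take_drop i).
apply: perm_cat; first by apply: IHk; rewrite -ltnS (leq_trans sL).
have -> : drop i w = \max_(x <- w) x :: drop i.+1 w.
  by rewrite (drop_nth 0) ?index_mem ?max_mem // /i nth_index ?max_mem.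
rewrite cats1 perm_rcons perm_cons.
by apply: IHk; rewrite -ltnS (leq_trans sR).
Qed.

(* The word p_1 ... p_n over {1, ..., n}; 'S_n permutes {0, ..., n-1}. *)
Definition word (n : nat) (p : 'S_n) : seq nat :=
  [seq (p i : nat).+1 | i <- enum 'I_n].

Lemma size_word n (p : 'S_n) : size (word p) = n.
Proof. by rewrite size_map size_enum_ord. Qed.

Lemma perm_eq_word n (p : 'S_n) : perm_eq (word p) (iota 1 n).
Proof.
have -> : word p = map succn (map val (map p (enum 'I_n))).
  by rewrite /word; elim: (enum _) => //= i s ->.
rewrite (iotaDl 1 0) -val_enum_ord; apply/perm_map/perm_map.
have Up : uniq (map p (enum 'I_n)) by rewrite (map_inj_uniq perm_inj) enum_uniq.
apply: uniq_perm; rewrite ?enum_uniq // => i.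
rewrite mem_enum; apply/mapP.
by exists (p^-1%g i); rewrite ?mem_enum ?permKV.
Qed.

Lemma word_inj n : injective (@word n).
Proof.
move=> p q /eq_in_map eqpq; apply/permP => i; apply/val_inj/succn_inj.
by apply: eqpq; rewrite mem_enum.
Qed.

Lemma word_surj n (w : seq nat) :
  perm_eq w (iota 1 n) -> exists p : 'S_n, word p == w.
Proof.
move=> pw.
have pw1 : perm_eq w [tuple (i : nat).+1 | i < n].
  apply: (perm_trans pw); rewrite (iotaDl 1 0) -val_enum_ord -map_comp.
  by apply/permEl.
have [p ->] := tuple_permP pw1.
by exists p; apply/eqP/eq_map => i; rewrite tnth_mktuple.
Qed.

Lemma stack_sort_word_ex n (p : 'S_n) :
  exists q : 'S_n, word q == stack_sort (word p).
Proof.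
apply: word_surj.
exact: perm_trans (stack_sort_perm_eq _) (perm_eq_word p).
Qed.

(* The map induced on S_n by stack-sorting words; see [word_stack_sort_perm]. *)
Definition stack_sort_perm (n : nat) (p : 'S_n) : 'S_n := xchoose (stack_sort_word_ex p).

Lemma word_stack_sort_perm n (p : 'S_n) : word (stack_sort_perm p) = stack_sort (word p).
Proof. exact/eqP/(xchooseP (stack_sort_word_ex p)). Qed.

Definition order_iso (u v : seq nat) : bool :=
  (size u == size v) &&
  [forall i : 'I_(size v), forall j : 'I_(size v),
     (nth 0 u i < nth 0 u j) == (nth 0 v i < nth 0 v j)].

(* The subsequences of w are the words [mask m w]. *)
Definition contains (w t : seq nat) : bool :=
  [exists m : (size w).-tuple bool, order_iso (mask m w) t].

Definition Av (n : nat) (ts : seq (seq nat)) : {set 'S_n} :=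
  [set p : 'S_n | all (fun t => ~~ contains (word p) t) ts].

(* The entry of w at position i, positions being numbered from 1. *)
Definition entry (w : seq nat) (i : nat) : nat := nth 0 w i.-1.

Definition descents (n : nat) (p : 'S_n) : nat :=
  let w := word p in
  \sum_(1 <= i < n) (entry w i > entry w i.+1).

Definition peaks (n : nat) (p : 'S_n) : nat :=
  let w := word p in
  \sum_(2 <= i < n) ((entry w i.-1 < entry w i) && (entry w i > entry w i.+1)).

Definition p132 : seq nat := [:: 1; 3; 2].
Definition p231 : seq nat := [:: 2; 3; 1].
Definition p312 : seq nat := [:: 3; 1; 2].

(* Main.v *)
(* Whether a permutation has a stack-sorting preimage of a given tree shape
   depends only on which factors end with their maximum. When it avoids 312, the
   factors of length at least 2 doing so are those whose last entry is an ascent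
   top, so the shapes of the preimages depend only on the ascent set; and the
   shape determines the ascents (hence descents and peaks) of the preimage.
   Finally both Av_n(132,312) and Av_n(231,312) contain exactly one permutation
   with each given ascent set. *)
Require Import Defs.
From mathcomp Require Import all_boot all_fingroup.
From mathcomp Require Import zify.

Set Implicit Arguments.
Unset Strict Implicit.
Unset Printing Implicit Defensive.

(** * Ascents of words and the splitting at the maximum *)

(* At [j = 0] the comparison is of an entry with itself, hence false. *)
Definition ascent (w : seq nat) (j : nat) : bool := nth 0 w j.-1 < nth 0 w j.

Lemma split_max w : uniq w -> w != [::] ->
  exists L N R, [/\ w = L ++ N :: R,
    all (fun x => x < N) L & all (fun x => x < N) R].
Proof.
move=> Uw /max_mem; set N := \max_(x <- w) x => Nw.
have leN x : x \in w -> x <= N by move=> xw; apply: leq_bigmax_seq.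
case/splitPr: Nw Uw leN => L R; rewrite uniq_catC /= mem_cat negb_or.
move=> /andP[/andP[NR NL] _] leN; exists L, N, R; split=> //.
  apply/allP=> x xL; rewrite ltn_neqAle leN ?mem_cat ?xL // andbT.
  by apply: contraNneq NL => <-.
apply/allP=> x xR; rewrite ltn_neqAle leN ?mem_cat ?inE ?xR ?orbT // andbT.
by apply: contraNneq NR => <-.
Qed.

Lemma ascent0 w : ascent w 0 = false.
Proof. exact: ltnn. Qed.

Lemma ascent_default w j : size w <= j -> ascent w j = false.
Proof. by move=> wj; rewrite /ascent (nth_default _ wj). Qed.

(** [N] is an ascent top unless it comes first. The entry after [N] is smaller than [N], so it is no
    ascent top, in agreement with [ascent0] for [R]. *)
Lemma ascent_cat_max L N R j :
    all (fun x => x < N) L -> all (fun x => x < N) R ->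
  j < size (L ++ N :: R) ->
  ascent (L ++ N :: R) j =
    if j < size L then ascent L j else
    if j == size L then 0 < j else ascent R (j - (size L).+1).
Proof.
move=> /allP ltL /allP ltR; rewrite size_cat /= => sj.
rewrite /ascent !nth_cat; case: (ltngtP j (size L)) => [jL|jL|jL].
- by rewrite (leq_ltn_trans (leq_pred _) jL).
- have [k jE] : exists k, j = (size L + k).+1 by exists (j - (size L).+1); lia.
  rewrite jE in sj *.
  rewrite subSS addKn subSn ?leq_addr // addKn /=.
  rewrite [size L + k < size L]ltnNge leq_addr /=.
  case: k {jE} sj => [|k] sj //=; rewrite ltnn; apply/negbTE; rewrite -leqNgt.
  by apply/ltnW/ltR/mem_nth; move: sj; rewrite -!addnS leq_add2l.
- rewrite jL subnn /=; case: L {ltR sj} ltL jL => [|x L] ltL jL /=.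
    by rewrite ltnn.
  by rewrite ltnSn ltL // mem_nth.
Qed.

(** * Stack-sorting and relabelling of values *)

(** A weak monotonicity: nothing is asked of pairs whose later entry is not an ascent top, so [r]
    may reorder the other values. *)
Definition raises_ascents (r : nat -> nat) (v : seq nat) : Prop :=
  forall i j, i < j < size v -> ascent v j -> r (nth 0 v i) < r (nth 0 v j).

(** From [i < j] follows [0 < j], so the predecessor of the entry at [j] also lies in [u], and the
    ascent is the same in the long word. *)
Lemma raises_ascents_infix r a u b :
  raises_ascents r (a ++ u ++ b) -> raises_ascents r u.
Proof.
have nu i : i < size u -> nth 0 (a ++ u ++ b) (size a + i) = nth 0 u i.
  by move=> iu; rewrite nth_cat ltnNge leq_addr /= addKn nth_cat iu.
move=> H i j /andP[ij ju] aj; have iu := ltn_trans ij ju.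
rewrite -!nu //; apply: H; first by rewrite !size_cat; lia.
have j0 := leq_ltn_trans (leq0n i) ij.
have -> : ascent (a ++ u ++ b) (size a + j) = ascent u j.
  rewrite /ascent -[(size a + j).-1](_ : size a + j.-1 = _); last by lia.
  by rewrite !nu // (leq_ltn_trans (leq_pred _) ju).
by [].
Qed.

(* Writing [w = L N R], the entry [N] is last and largest in [stack_sort w],
   hence an ascent top there, so [r N] is the largest entry of [map r w]:
   sorting [w] and sorting [map r w] perform the same splittings. *)
Lemma stack_sort_map r w : uniq w -> raises_ascents r (stack_sort w) ->
  stack_sort (map r w) = map r (stack_sort w) /\
  (forall j, j < size w -> ascent (map r w) j = ascent w j).
Proof.
have [m] := ubnP (size w); elim: m w => // m IHm w sw Uw.
have [->|w0] := eqVneq w [::]; first by [].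
have [L [N [R [wE ltL ltR]]]] := split_max Uw w0.
rewrite wE in Uw sw *; rewrite size_cat /= addnS ltnS in sw.
move: Uw; rewrite cat_uniq /= => /and3P[UL _ /andP[_ UR]].
rewrite stack_sort_max // => H.
have [IHL aL] : stack_sort (map r L) = map r (stack_sort L) /\
    (forall j, j < size L -> ascent (map r L) j = ascent L j).
  apply: IHm => //; first exact: leq_ltn_trans (leq_addr _ _) sw.
  exact: (@raises_ascents_infix _ [::] _ _ H).
have [IHR aR] : stack_sort (map r R) = map r (stack_sort R) /\
    (forall j, j < size R -> ascent (map r R) j = ascent R j).
  apply: IHm => //; first exact: leq_ltn_trans (leq_addl _ _) sw.
  exact: raises_ascents_infix H.
set u := stack_sort L ++ stack_sort R.
have ltu x : x \in u -> x < N.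
  rewrite mem_cat !(perm_mem (stack_sort_perm_eq _)).
  by case/orP=> [/(allP ltL)|/(allP ltR)].
have ltru x : x \in u -> r x < r N.
  move=> xu; have iu : index x u < size u by rewrite index_mem.
  have := H (index x u) (size u); rewrite catA -/u /ascent !(nth_cat _ u) iu ltnn.
  rewrite subnn [nth 0 [:: N] 0]/= nth_index // size_cat /= addn1 ltnSn; apply=> //.
  (* As [x] lies in [u], [u] is nonempty and [N] has a smaller predecessor. *)
  have ju : (size u).-1 < size u by rewrite prednK // (leq_ltn_trans _ iu).
  by rewrite ju ltu // mem_nth.
have ltrL : all (fun x => x < r N) (map r L).
  apply/allP=> _ /mapP[x xL ->]; apply: ltru.
  by rewrite mem_cat (perm_mem (stack_sort_perm_eq _)) xL.
have ltrR : all (fun x => x < r N) (map r R).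
  apply/allP=> _ /mapP[x xR ->]; apply: ltru.
  by rewrite mem_cat !(perm_mem (stack_sort_perm_eq _)) xR orbT.
rewrite map_cat /= stack_sort_max // IHL IHR !map_cat; split=> // j jw.
rewrite !ascent_cat_max //; last by move: jw; rewrite !size_cat /= !size_map.
rewrite !size_map; case: ltngtP => // jL; first exact: aL.
by apply: aR; move: jw; rewrite size_cat /= -addSnnS ltn_subLR.
Qed.

(** * Occurrences of three-letter patterns *)

Lemma subseq_cons_nth (x : nat) s w :
  reflect (exists2 i, i < size w & nth 0 w i = x /\ subseq s (drop i.+1 w))
          (subseq (x :: s) w).
Proof.
elim: w => [|y w IHw] /=; first by right; case.
case: eqP => [->|xy].
  apply: (iffP idP) => [sw|[[|i] /= iw [xE sw]]]; rewrite ?drop0 //.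
  - by exists 0; rewrite //= drop0.
  - by move: sw; rewrite drop0.
  - exact: subseq_trans sw (drop_subseq _ _).
apply: (iffP IHw) => [[i iw [xE sw]]|[[|i] iw [/= xE sw]]].
- by exists i.+1.
- by case: xy.
- by exists i.
Qed.

Lemma order_iso3 x y z a b c :
  order_iso [:: x; y; z] [:: a; b; c] =
    [&& (x < y) == (a < b), (x < z) == (a < c), (y < x) == (b < a),
        (y < z) == (b < c), (z < x) == (c < a) & (z < y) == (c < b)].
Proof.
rewrite /order_iso /=; apply/forallP/idP => [H|H i].
  have h i j (Hi : i < 3) (Hj : j < 3) := forallP (H (Ordinal Hi)) (Ordinal Hj).
  have := (h 0 1 isT isT, h 0 2 isT isT, h 1 0 isT isT, h 1 2 isT isT,
           h 2 0 isT isT, h 2 1 isT isT).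
  by move=> /= [[[[[-> ->] ->] ->] ->] ->].
case/and5P: H => h1 h2 h3 h4 /andP[h5 h6].
apply/forallP=> j.
by case: i => [[|[|[|]]]] //= _; case: j => [[|[|[|]]]] //= _; rewrite ?ltnn.
Qed.

(** * Permutations and the comparisons of their entries *)

Section Words.

Variable n : nat.
Implicit Types (p q : 'S_n) (i j k : 'I_n).

Lemma nth_word p i : nth 0 (word p) i = (p i).+1.
Proof. by rewrite (nth_map i) ?size_enum_ord // nth_ord_enum. Qed.

Lemma word_uniq p : uniq (word p).
Proof. by rewrite (perm_uniq (perm_eq_word p)) iota_uniq. Qed.

Lemma ascent_word p i j : j = i.+1 :> nat -> ascent (word p) j = (p i < p j).
Proof. by move=> ji; rewrite /ascent nth_word ji /= nth_word ltnS. Qed.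

Lemma perm_gtNlt p i j : i < j -> (p j < p i) = ~~ (p i < p j).
Proof.
by move=> ij; case: (ltngtP (p i)) ij => // /val_inj/perm_inj->; rewrite ltnn.
Qed.

Lemma perm_valE p i : p i = #|[set k | p k < p i]| :> nat.
Proof.
rewrite -(card_imset _ (@perm_inj _ p)).
have -> : p @: [set k | p k < p i] = [set x : 'I_n | x < p i].
  apply/setP=> x; apply/imsetP/idP => [[k]|]; first by rewrite !inE => h ->.
  by rewrite inE => h; exists (p^-1%g x); rewrite ?inE ?permKV.
by rewrite cardsE -sum1_card (big_ord_narrow (ltnW (ltn_ord _))) sum1_card card_ord.
Qed.

Lemma perm_lt_inj p q :
  (forall i j, i < j -> (p i < p j) = (q i < q j)) -> p = q.
Proof.
move=> eqpq; apply/permP=> i; apply: val_inj.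
rewrite /= (perm_valE p) (perm_valE q).
apply: eq_card => k; rewrite !inE; case: (ltngtP k i) => [ki|ik|/val_inj->].
- exact: eqpq.
- by rewrite (perm_gtNlt p ik) (perm_gtNlt q ik) eqpq.
- by rewrite !ltnn.
Qed.

(** The permutation sends [i] to the rank of [f i], the number of [k] with [f k < f i]. It serves to
    build permutations from integer keys. *)
Lemma standardize (f : 'I_n -> nat) : injective f ->
  exists p, forall i j, (p i < p j) = (f i < f j).
Proof.
move=> f_inj; pose S i := [set k | f k < f i].
have SS i j : f i < f j -> #|S i| < #|S j|.
  move=> fij; apply: proper_card; apply/properP; split.
    by apply/subsetP=> k; rewrite !inE => /ltn_trans; apply.
  by exists i; rewrite !inE ?ltnn.
have Slt i : #|S i| < n.
  have SiT : S i \proper [set: 'I_n].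
    by apply/properP; split; [exact: subsetT | exists i; rewrite ?inE ?ltnn].
  by have := proper_card SiT; rewrite cardsT card_ord.
pose g i := Ordinal (Slt i).
have gE i j : (g i < g j) = (f i < f j).
  rewrite /=; case: (ltngtP (f i) (f j)) => [/SS->|/SS/ltnW|/f_inj->].
  - by [].
  - by rewrite leqNgt => /negPf.
  - by rewrite ltnn.
have g_inj : injective g.
  move=> i j gij; apply: f_inj; apply/eqP; rewrite eqn_leq.
  by apply/andP; split; rewrite leqNgt -gE gij ltnn.
by exists (perm g_inj) => i j; rewrite !permE gE.
Qed.

Lemma contains_word3 p a b c :
  reflect (exists i j k, [/\ i < j, j < k &
             order_iso [:: (p i).+1; (p j).+1; (p k).+1] [:: a; b; c]])
          (contains (word p) [:: a; b; c]).
Proof.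
apply: (iffP existsP) => [[m oi]|[i [j [k [ij jk oi]]]]].
  case E: (mask m (word p)) (oi) => [|x [|y [|z [|? ?]]]] // {}oi.
  have: subseq [:: x; y; z] (word p) by rewrite -E mask_subseq.
  case/subseq_cons_nth=> i; rewrite size_word => iw [xE].
  case/subseq_cons_nth=> j; rewrite size_drop size_word nth_drop => jw [yE].
  case/subseq_cons_nth=> k; rewrite drop_drop size_drop size_word nth_drop.
  move=> kw [zE _].
  have jn : i.+1 + j < n by lia.
  have kn : (j.+1 + i.+1) + k < n by lia.
  exists (Ordinal iw), (Ordinal jn), (Ordinal kn).
  rewrite -!nth_word /= xE yE zE; split=> //; lia.
have : subseq [:: (p i).+1; (p j).+1; (p k).+1] (word p).
  apply/subseq_cons_nth; exists i; rewrite ?size_word ?nth_word //; split=> //.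
  apply/subseq_cons_nth; exists (j - i.+1).
    by rewrite size_drop size_word ltn_sub2r // (leq_ltn_trans ij).
  rewrite nth_drop subnKC // nth_word; split=> //.
  rewrite drop_drop addSn subnK //.
  apply/subseq_cons_nth; exists (k - j.+1).
    by rewrite size_drop size_word ltn_sub2r // (leq_ltn_trans jk).
  by rewrite nth_drop subnKC // nth_word sub0seq.
case/subseqP=> m sm E; have /eqP sm' := sm.
by exists (Tuple sm'); rewrite /= -E.
Qed.

(** * Avoidance as a condition on comparisons *)

(** In both patterns the last entry lies strictly between the two earlier ones; excluding this makes
    each entry compare alike with all earlier ones. *)
Lemma Av132_312P p :
  reflect (forall i j k, i < j -> j < k -> (p i < p k) = (p j < p k))
          (p \in Av n [:: p132; p312]).
Proof.
rewrite inE /= andbT.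
apply: (iffP andP) => [[N1 N2] i j k ij jk|H].
  have ik := ltn_trans ij jk.
  have := (perm_gtNlt p ij, perm_gtNlt p jk, perm_gtNlt p ik).
  move=> [[e1 e2] e3]; apply/idP/idP => h; apply: contraTT isT => h'.
    case/contains_word3: N1; exists i, j, k; split=> //; rewrite order_iso3.
    lia.
  case/contains_word3: N2; exists i, j, k; split=> //; rewrite order_iso3.
  lia.
split; apply/contains_word3 => -[i [j [k [ij jk]]]]; rewrite order_iso3;
  have := H i j k ij jk; lia.
Qed.

(** A failure of the first implication is an occurrence of 231, a failure of the second one of
    312. *)
Lemma Av231_312P p :
  reflect (forall i j k, i < j -> j < k ->
             (p i < p j -> p i < p k) /\ (p j < p k -> p i < p k))
          (p \in Av n [:: p231; p312]).
Proof.
rewrite inE /= andbT.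
apply: (iffP andP) => [[N1 N2] i j k ij jk|H].
  have ik := ltn_trans ij jk.
  have := (perm_gtNlt p ij, perm_gtNlt p jk, perm_gtNlt p ik).
  move=> [[e1 e2] e3]; split=> h; apply: contraTT isT => h'.
    case/contains_word3: N1; exists i, j, k; split=> //; rewrite order_iso3.
    lia.
  case/contains_word3: N2; exists i, j, k; split=> //; rewrite order_iso3.
  lia.
split; apply/contains_word3 => -[i [j [k [ij jk]]]]; rewrite order_iso3;
  have := H i j k ij jk; lia.
Qed.

Lemma ascent_word_eq p q :
  (forall i j, j = i.+1 :> nat -> (p i < p j) = (q i < q j)) ->
  ascent (word p) =1 ascent (word q).
Proof.
move=> H [|j]; first by rewrite !ascent0.
have [jn|nj] := ltnP j.+1 n; last by rewrite !ascent_default ?size_word.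
have aE r : ascent (word r) j.+1 = (r (Ordinal (ltnW jn)) < r (Ordinal jn)).
  exact: (@ascent_word r (Ordinal (ltnW jn)) (Ordinal jn) erefl).
by rewrite !aE; apply: H.
Qed.

(** Each entry is a new maximum or a new minimum, so comparing it with its predecessor decides all
    comparisons with earlier entries. *)
Lemma Av132_312_lt p i j : p \in Av n [:: p132; p312] -> i < j ->
  (p i < p j) = ascent (word p) j.
Proof.
move=> /Av132_312P H ij.
have kn : j.-1 < n by apply: leq_ltn_trans (leq_pred _) (ltn_ord j).
pose k := Ordinal kn; have jk : j = k.+1 :> nat by rewrite /=; lia.
rewrite (ascent_word _ jk); have [ik|ki|/val_inj->//] := ltngtP i k.
  by apply: H => //; rewrite jk.
by move: ki; rewrite /=; lia.
Qed.

(** Without an ascent between them the entries decrease from [i] to [j]. An ascent top at [k]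
    exceeds the entry at [i] by avoidance of 312, and then so does the entry at [j] by avoidance of
    231. *)
Lemma Av231_312_lt p i j : p \in Av n [:: p231; p312] -> i < j ->
  (p i < p j) = [exists k : 'I_n, (i < k <= j) && ascent (word p) k].
Proof.
move=> /Av231_312P H ij; apply/idP/idP => [|/existsP[k /andP[/andP[ik kj] ak]]].
  apply: contraTT => /existsP noasc; rewrite -leqNgt -ltnS -!nth_word.
  have : forall m, i + m <= j -> nth 0 (word p) (i + m) <= nth 0 (word p) i.
    elim=> [|m IHm] imj; first by rewrite addn0.
    have kn : i + m.+1 < n by rewrite (leq_ltn_trans imj).
    apply: leq_trans (IHm _); last by lia.
    rewrite leqNgt; apply/negP => am; apply: noasc; exists (Ordinal kn).
    by rewrite /ascent /= imj addnS /= leq_addr -addnS.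
  by move/(_ (j - i)); rewrite subnKC ?(ltnW ij) //; apply.
have ltik : p i < p k.
  have ln : k.-1 < n by apply: leq_ltn_trans (leq_pred _) (ltn_ord k).
  pose l := Ordinal ln; have kl : k = l.+1 :> nat by rewrite /=; lia.
  move: ak; rewrite (ascent_word _ kl).
  have [il|li|/val_inj->//] := ltngtP i l.
    by apply: (H i l k _ _).2 => //; rewrite kl.
  by move: li; rewrite /=; lia.
move: kj; rewrite leq_eqVlt => /orP[/eqP/val_inj<-//|kj].
exact: (H i k j _ _).1.
Qed.

(** * One permutation of each class for each ascent set *)

Lemma Av132_312_ascent_inj :
  {in Av n [:: p132; p312] &, forall p q,
    ascent (word p) =1 ascent (word q) -> p = q}.
Proof.
move=> p q Ap Aq eqa; apply: perm_lt_inj => i j ij.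
by rewrite !Av132_312_lt.
Qed.

Lemma Av231_312_ascent_inj :
  {in Av n [:: p231; p312] &, forall p q,
    ascent (word p) =1 ascent (word q) -> p = q}.
Proof.
move=> p q Ap Aq eqa; apply: perm_lt_inj => i j ij.
by rewrite !Av231_312_lt //; apply: eq_existsb => k; rewrite eqa.
Qed.

Lemma Av132_312_ascent_surj p :
  exists2 q, q \in Av n [:: p132; p312] & ascent (word q) =1 ascent (word p).
Proof.
pose a := ascent (word p).
(* Keys of positions before [j] are at distance less than [j] from [n], so the key of [j] lies above
   all of them or below all of them. *)
pose key (j : 'I_n) := if a j then n + j else n - j.
have key_lt i j : i < j -> (key i < key j) = a j.
  by move=> ij; rewrite /key; have := ltn_ord j; do 2!case: ifP => _; lia.
have key_inj : injective key.
  have key_neq i j : i < j -> key i <> key j.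
    by move=> ij; rewrite /key; have := ltn_ord j; do 2!case: ifP => _; lia.
  move=> i j eqk; apply: val_inj; case: (ltngtP i j) => // [/key_neq|/key_neq].
    by rewrite eqk.
  by rewrite eqk.
have [q qE] := standardize key_inj; exists q.
  apply/Av132_312P => i j k ij jk; rewrite !qE !key_lt //.
  exact: ltn_trans jk.
by apply: ascent_word_eq => i j ji; rewrite qE key_lt ?ji // -(ascent_word p ji) ji.
Qed.

(* The layered permutation: [c j] is the number of the layer of [j]. *)
Lemma Av231_312_ascent_surj p :
  exists2 q, q \in Av n [:: p231; p312] & ascent (word q) =1 ascent (word p).
Proof.
pose a := ascent (word p).
pose c m := \sum_(l < m.+1) a l.
have cS m : c m.+1 = c m + a m.+1 by rewrite /c big_ord_recr.
have c_mono : {homo c : l m / l <= m}.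
  apply: homo_leq => [m|m l k|m]; [exact: leqnn | exact: leq_trans |].
  by rewrite cS leq_addr.
(* As [n - j] lies between 1 and [n], keys of different layers do not interleave; within a layer
   they decrease. *)
pose key (j : 'I_n) := c j * n + (n - j).
have key_lt i j : i < j -> (key i < key j) = (c i < c j).
  move=> ij; rewrite /key; have := ltn_ord j.
  have := c_mono _ _ (ltnW ij); rewrite leq_eqVlt => /orP[/eqP->|cij].
    by rewrite ltnn; lia.
  by have := leq_mul cij (leqnn n); rewrite cij mulSn; lia.
have key_inj : injective key.
  have key_neq i j : i < j -> key i <> key j.
    move=> ij; have := key_lt _ _ ij; rewrite /key; have := ltn_ord j.
    have := c_mono _ _ (ltnW ij); rewrite leq_eqVlt => /orP[/eqP->|->].
      by lia.
    by move=> _ + eqk; rewrite eqk ltnn.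
  move=> i j eqk; apply: val_inj; case: (ltngtP i j) => // [/key_neq|/key_neq].
    by rewrite eqk.
  by rewrite eqk.
have [q qE] := standardize key_inj; exists q.
  apply/Av231_312P => i j k ij jk; have ik := ltn_trans ij jk.
  rewrite !qE !key_lt //.
  have := (c_mono _ _ (ltnW ij), c_mono _ _ (ltnW jk)).
  by case=> cij cjk; split=> h; [apply: leq_trans cjk | apply: leq_ltn_trans h].
apply: ascent_word_eq => i j ji; rewrite qE key_lt ji // cS -(ascent_word p ji).
by rewrite ji -/(a _); case: (a _); rewrite ?addn1 ?addn0 ?ltnn ?ltnSn.
Qed.

(** * Injections between the sets of preimages *)

(** Products compose from left to right, so [p^-1 * q] acts on values, turning [p i] into [q i]. As
    [r] is independent of [s], the case [s = p] shows that it maps [word p] to [word q]. *)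
Lemma word_relabel p q :
  exists r, forall s : 'S_n, word (s * (p^-1 * q))%g = map r (word s).
Proof.
exists (fun x => nth 0 (word q) (index x (word p))) => s.
have rE i : nth 0 (word q) (index (p i).+1 (word p)) = (q i).+1.
  by rewrite -nth_word index_uniq ?word_uniq ?size_word // nth_word.
rewrite -map_comp; apply: eq_map => i /=.
by have := rE (p^-1%g (s i)); rewrite permKV !permM => ->.
Qed.

(* If [s] is stack-sorted to [p] and [q \in B] has the ascents of [p], then
   relabelling the values of [s] by [p^-1 q] gives a permutation with the ascents
   of [s] that is stack-sorted to [q]. *)
Lemma card_stack_sort_preim_le (A B : {set 'S_n}) (P : pred 'S_n) :
  {in A &, forall p q, ascent (word p) =1 ascent (word q) -> p = q} ->
  (forall p, exists2 q, q \in B & ascent (word q) =1 ascent (word p)) ->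
  {in B, forall q i j, i < j -> ascent (word q) j -> q i < q j} ->
  (forall s t, ascent (word s) =1 ascent (word t) -> P s = P t) ->
  #|[set s in @stack_sort_perm n @^-1: A | P s]| <=
  #|[set s in @stack_sort_perm n @^-1: B | P s]|.
Proof.
move=> injA surjB maxB ascP.
have /fin_all_exists[f fP] : forall p, exists q,
    q \in B /\ ascent (word q) =1 ascent (word p).
  by move=> p; have [q qB qa] := surjB p; exists q.
pose g s := (s * ((stack_sort_perm s)^-1 * f (stack_sort_perm s)))%g.
have gP s : stack_sort_perm (g s) = f (stack_sort_perm s) /\
    ascent (word (g s)) =1 ascent (word s).
  set p := stack_sort_perm s; have [fB fa] := fP p.
  have [r rE] := word_relabel p (f p).
  have rp : map r (word p) = word (f p) by rewrite -rE mulKVg.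
  have [||srt asc] := @stack_sort_map r (word s); first exact: word_uniq.
    (* [r] raises ascents because [f p] has the ascents of [p] and, lying in [B], has each ascent
       top above all earlier entries. *)
    rewrite -word_stack_sort_perm -/p => i j; rewrite size_word => /andP[ij jn].
    have iin := ltn_trans ij jn.
    have rn l : l < n -> r (nth 0 (word p) l) = nth 0 (word (f p)) l.
      by move=> ln; rewrite -rp (nth_map 0) ?size_word.
    rewrite -fa !rn // => aj.
    rewrite -[i]/(Ordinal iin : nat) -[j]/(Ordinal jn : nat) !nth_word ltnS.
    exact: maxB.
  split; first by apply: word_inj; rewrite word_stack_sort_perm rE srt -rp
                    -word_stack_sort_perm.
  move=> j; rewrite rE; have [jn|nj] := ltnP j n; first by rewrite asc ?size_word.
  by rewrite !ascent_default ?(size_map r) ?size_word.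
have g_inj : {in [set s in @stack_sort_perm n @^-1: A | P s] &, injective g}.
  move=> s t; rewrite !inE => /andP[sA _] /andP[tA _] eqg.
  (* Sorting [g s] gives [f] of the sorted [s], whose ascents identify the sorted [s] within [A];
     the relabelling can then be cancelled. *)
  have eqst : stack_sort_perm s = stack_sort_perm t.
    apply: injA => // j; rewrite -(fP (stack_sort_perm s)).2.
    by rewrite -(fP (stack_sort_perm t)).2 -(gP s).1 -(gP t).1 eqg.
  by move: eqg; rewrite /g eqst => /mulIg.
rewrite -(card_in_imset g_inj); apply: subset_leq_card.
apply/subsetP=> _ /imsetP[s + ->]; rewrite !inE => /andP[sA Ps].
by rewrite (gP s).1 (fP _).1 (ascP _ s) //; exact: (gP s).2.
Qed.

(** The two classes can exchange roles in the preceding inequality. *)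
Lemma card_stack_sort_preim (P : pred 'S_n) :
  (forall s t, ascent (word s) =1 ascent (word t) -> P s = P t) ->
  #|[set s in @stack_sort_perm n @^-1: Av n [:: p132; p312] | P s]| =
  #|[set s in @stack_sort_perm n @^-1: Av n [:: p231; p312] | P s]|.
Proof.
move=> ascP; apply/eqP; rewrite eqn_leq; apply/andP; split;
  apply: card_stack_sort_preim_le => //.
- exact: Av132_312_ascent_inj.
- exact: Av231_312_ascent_surj.
- move=> q Bq i j ij aj; rewrite Av231_312_lt //; apply/existsP; exists j.
  by rewrite ij leqnn.
- exact: Av231_312_ascent_inj.
- exact: Av132_312_ascent_surj.
- by move=> q Aq i j ij aj; rewrite Av132_312_lt.
Qed.

(** * Descents and peaks in terms of ascents *)

(** [entry] counts positions from 1 and [ascent] from 0, so both sides compare the same two entries,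
    which are distinct. *)
Lemma descent_word p (m : nat) : 0 < m < n ->
  (entry (word p) m > entry (word p) m.+1) = ~~ ascent (word p) m.
Proof.
move=> /andP[m0 mn]; rewrite /entry /ascent /= -leqNgt ltn_neqAle.
rewrite nth_uniq ?word_uniq ?size_word //; last by lia.
by have -> : (m == m.-1) = false by lia.
Qed.

Lemma descents_ascent p q :
  ascent (word p) =1 ascent (word q) -> descents p = descents q.
Proof.
move=> eqa; apply: eq_big_nat => k kn.
by rewrite !descent_word // eqa.
Qed.

Lemma peaks_ascent p q :
  ascent (word p) =1 ascent (word q) -> peaks p = peaks q.
Proof.
move=> eqa; apply: eq_big_nat => k /andP[k2 kn].
rewrite !descent_word; try by rewrite kn (ltnW k2).
(* The rising half of a peak at [k] is an ascent at [k.-1], by the same shift of positions. *)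
by rewrite -![_ < entry _ k]/(ascent _ k.-1) !eqa.
Qed.

End Words.

Theorem theorem10p1 (n : nat) (hn : 0 < n) :
  [/\ #|@stack_sort_perm n @^-1: Av n [:: p132; p312]| =
      #|@stack_sort_perm n @^-1: Av n [:: p231; p312]|,
      forall m : nat,
        #|[set p in @stack_sort_perm n @^-1: Av n [:: p132; p312] | descents p == m]| =
        #|[set p in @stack_sort_perm n @^-1: Av n [:: p231; p312] | descents p == m]|
    & forall m : nat,
        #|[set p in @stack_sort_perm n @^-1: Av n [:: p132; p312] | peaks p == m]| =
        #|[set p in @stack_sort_perm n @^-1: Av n [:: p231; p312] | peaks p == m]| ].
Proof.
split=> [|m|m].
(* The unrestricted count is the case of the constantly true predicate. *)
- have setIT (A : {set 'S_n}) : [set p in A | predT p] = A.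
    by apply/setP=> p; rewrite inE andbT.
  by rewrite -[LHS]/#|pred_of_set _| -(setIT (_ @^-1: Av n [:: p132; p312]))
    -(setIT (_ @^-1: Av n [:: p231; p312])); apply: card_stack_sort_preim.
- by apply: card_stack_sort_preim => s t /descents_ascent->.
- by apply: card_stack_sort_preim => s t /peaks_ascent->.
Qed.
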